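(* For any real number $x\in(0,1)$ and any integers $n\ge 3$ and $k\in\{1,\ldots,n-2\}$, there exists a disjoint partition $\{n_1,\ldots,n_k\}\sqcup\{m_1,\ldots,m_{n-k-1}\}$ of the set $\{1,2,\ldots,n-1\}$ such that $$n_i\le\frac{i}{x},\quad i\in\{1,\ldots,k\},\qquad\text{and}\qquad m_i\le\frac{i}{1-x},\quad i\in\{1,\ldots,n-k-1\}.$$
   Context: Here $n_1,\ldots,n_k,m_1,\ldots,m_{n-k-1}$ are $n-1$ pairwise distinct integers whose set is $\{1,2,\ldots,n-1\}$. *)

(* Defs.v *)
From mathcomp Require Import all_boot all_order all_algebra reals.
Set Implicit Arguments.
Unset Strict Implicit.
Unset Printing Implicit Defensive.
Import Order.TTheory GRing.Theory Num.Theory.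

(* s = (n_1, ..., n_k) and t = (m_1, ..., m_{n-k-1}) are the enumerations, in
   some order, of the two parts of a disjoint partition of {1, ..., n - 1}.
   Tuples are indexed from 0: n_i is [tnth s] at index i - 1. *)
Definition enum_partition (n k : nat)
    (s : k.-tuple nat) (t : (n - k - 1).-tuple nat) : Prop :=
  uniq (s ++ t) /\ forall j : nat, (j \in s ++ t) = (1 <= j <= n - 1)%N.

(* Main.v *)
Require Import Defs.
From mathcomp Require Import all_boot all_order all_algebra reals.
From mathcomp Require Import zify lra.
Import Order.TTheory GRing.Theory Num.Theory.
Local Open Scope ring_scope.

(** Induction on N = n - 1. With a and b entries still to be chosen in the two
    parts, a + b = N, the largest element N may be put last in the first part
    if N x <= a and last in the second one if N (1 - x) <= b. One of these
    holds, since N x + N (1 - x) = a + b. *)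

(** The denominator of [i / y] is cleared, so that no division is involved; position [i], counted
    from 0, carries the index [i.+1]. *)
Definition density_bounded {R : numDomainType} (y : R) (s : seq nat) : Prop :=
  forall i : nat, (i < size s)%N -> (nth 0%N s i)%:R * y <= i.+1%:R.

Lemma density_bounded_rcons (R : numDomainType) (y : R) (s : seq nat) (m : nat) :
  density_bounded y s -> m%:R * y <= (size s).+1%:R ->
  density_bounded y (rcons s m).
Proof.
move=> s_y m_y i; rewrite size_rcons ltnS leq_eqVlt nth_rcons.
by case/predU1P => [->|lt_is]; [rewrite ltnn eqxx | rewrite lt_is s_y].
Qed.

(** Arbitrary sizes, zero included, keep the induction going: taking out the largest element lowers
    just one of [a] and [b], so a part may become empty. *)
Lemma density_bounded_partition {R : realDomainType} {x : R} {N a b : nat} :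
  0 < x < 1 -> (a + b)%N = N ->
  exists s t : seq nat,
    [/\ size s = a, size t = b, perm_eq (s ++ t) (iota 1 N),
        density_bounded x s & density_bounded (1 - x) t].
Proof.
case/andP=> x_gt0 x_lt1; elim: N a b => [|N IHN] a b abN.
  by exists [::], [::]; split=> //=; lia.
have iotaS : iota 1 N.+1 = rcons (iota 1 N) N.+1.
  by rewrite -[N.+1 in LHS]addn1 iotaD -cats1.
have [Na|aN] := lerP (N.+1%:R * x) a%:R.
  (* A place is left in the first part, since [a = 0] would contradict [0 < N.+1%:R * x]. From here
     on [a.+1] is the index that [N.+1] receives, and [Na] is the bound required of it. *)
  case: a => [|a] in abN Na *; first by rewrite leNgt mulr_gt0 in Na.
  have [|s [t [sa tb st_perm s_x t_x]]] := IHN a b; first by lia.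
  exists (rcons s N.+1), t; split; rewrite ?size_rcons ?sa //; last first.
    by apply: density_bounded_rcons; rewrite ?sa.
  (* Here [N.+1] sits between [s] and [t]; it is brought to the front on both sides and
     cancelled. *)
  rewrite iotaS cat_rcons perm_catC cat_cons perm_sym perm_rcons perm_cons.
  by rewrite perm_sym perm_catC.
have Nb : N.+1%:R * (1 - x) <= b%:R.
  have : a%:R + b%:R = N.+1%:R :> R by rewrite -abN natrD.
  by rewrite mulrBr mulr1; lra.
case: b => [|b] in abN Nb *; first by rewrite leNgt mulr_gt0 ?subr_gt0 in Nb.
have [|s [t [sa tb st_perm s_x t_x]]] := IHN a b; first by lia.
exists s, (rcons t N.+1); split; rewrite ?size_rcons ?tb //.
  by rewrite iotaS -rcons_cat -!cats1 perm_cat2r.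
by apply: density_bounded_rcons; rewrite ?tb.
Qed.

Theorem lemma3p1 (R : realType) (x : R) (n k : nat)
    (hx : 0 < x < 1) (hn : (3 <= n)%N) (hk : (1 <= k <= n - 2)%N) :
  exists (s : k.-tuple nat) (t : (n - k - 1).-tuple nat),
    [/\ enum_partition s t,
        forall i : 'I_k, (tnth s i)%:R <= (i.+1)%:R / x
      & forall i : 'I_(n - k - 1), (tnth t i)%:R <= (i.+1)%:R / (1 - x)].
Proof.
(* Subtraction truncates at 0; the range of [k] makes it exact here. *)
have kN : (k + (n - k - 1) = n - 1)%N by lia.
have [s [t [/eqP sk /eqP tk st_perm s_x t_x]]] :=
  density_bounded_partition hx kN.
case/andP: hx => x_gt0 x_lt1.
exists (Tuple sk), (Tuple tk); split=> [|i|i] /=.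
- split=> [|j]; first by rewrite (perm_uniq st_perm) iota_uniq.
  by rewrite (perm_mem st_perm) mem_iota add1n ltnS.
- by rewrite ler_pdivlMr // (tnth_nth 0%N) s_x // (eqP sk).
- by rewrite ler_pdivlMr ?subr_gt0 // (tnth_nth 0%N) t_x // (eqP tk).
Qed.
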